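(* Let $\epsilon_0,\dots,\epsilon_7$ be the standard basis of $\mathbb{R}^8$, and for distinct $0\le i,j\le 7$ let $\mathbf v_{i,j}=\mathbf v_{j,i}=4(\epsilon_i+\epsilon_j)-\sum_{k=0}^7\epsilon_k$. Let $\Psi=\{\pm\mathbf v_{i,j}:0\le i<j\le 7\}$ ($56$ vectors) and $\Delta=\{\alpha_0,\dots,\alpha_7\}$, where $\alpha_i=4(\epsilon_i-\epsilon_{i+1})$ for $0\le i<7$ and $\alpha_7=(-2,-2,-2,-2,2,2,2,2)$. (i) The $56$-dimensional $\mathbb{C}$-vector space $V_\Psi$ has the structure of a $\mathfrak g$-module (via the operators $E_{\mathbf a},F_{\mathbf a},H_{\mathbf a}$, $\mathbf a\in\Delta$), where $\mathfrak g$ is the derived affine Kac--Moody algebra of type $E_7^{(1)}$. (ii) Let $\Psi'=\Psi$ and $\Delta'=\Delta\setminus\{\alpha_0\}$. Then $\Psi'$ is a minuscule system with respect to the simple system $\Delta'$, and $V_{\Psi'}$ is a module for the simple Lie algebra $\mathfrak e_7$ over $\mathbb{C}$ of type $E_7$. It is an irreducible module with highest weight vector $b_{-\mathbf v_{0,7}}$ and lowest weight vector $b_{\mathbf v_{0,7}}$. (iii) Let $\mathbf n=\mathbf v_{0,7}$. For $l\in\mathbb{R}$ put $\Psi(\mathbf n,l)=\{\mathbf v\in\Psi:\mathbf v\cdot\mathbf n=l\}$ and $\Delta(\mathbf n)=\{\mathbf a\in\Delta:\mathbf a\cdot\mathbf n=0\}$. Then there is a disjoint union $\Psi=\Psi(\mathbf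 n,24)\,\dot\cup\,\Psi(\mathbf n,8)\,\dot\cup\,\Psi(\mathbf n,-8)\,\dot\cup\,\Psi(\mathbf n,-24)$. For $l\in\{24,8,-8,-24\}$, $\Psi(\mathbf n,l)$ is a minuscule system with respect to the simple system $\Delta(\mathbf n)=\Delta\setminus\{\alpha_0,\alpha_6\}$, and $V_{\Psi(\mathbf n,l)}$ is a module for the simple Lie algebra $\mathfrak e_6$ over $\mathbb{C}$ of type $E_6$. The two modules $V_{\Psi(\mathbf n,\pm 24)}$ are trivial one-dimensional modules for $\mathfrak e_6$, whereas the two modules $V_{\Psi(\mathbf n,\pm 8)}$ are nonisomorphic $27$-dimensional irreducible modules. The module $V_{\Psi(\mathbf n,8)}$ has highest weight vector $b_{\mathbf v_{1,7}}$ and lowest weight vector $b_{\mathbf v_{0,6}}$. The module $V_{\Psi(\mathbf n,-8)}$ has highest weight vector $b_{-\mathbf v_{0,6}}$ and lowest weight vector $b_{-\mathbf v_{1,7}}$. (iv) For $l\in\{24,8,-8,-24\}$, $\Psi(\mathbf n,l)$ is a minuscule system with respect to the simple system $\Delta(\mathbf n)\cup\{\alpha\}$, where $\alpha=4(\epsilon_0-\epsilon_7)$. This makes $V_{\Psi(\mathbf n,l)}$ into a module for the derived affine Kac--Moody algebra of type $E_6^{(1)}$.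
   Context: Minuscule systems: $\mathbb{R}^n$ carries the usual scalar product. Let $\Psi,\Delta\subset\mathbb{R}^n$ with $0\notin\Delta$. $\Psi$ is a minuscule system with respect to the simple system $\Delta$ if for every $\mathbf v\in\Psi$ and $\mathbf a\in\Delta$: (i) $2\,\mathbf v\cdot\mathbf a = c\,\mathbf a\cdot\mathbf a$ for some $c=c(\mathbf v,\mathbf a)\in\{-1,0,1\}$; (ii) $\mathbf v+\mathbf a\in\Psi$ if and only if $c=-1$, and $\mathbf v-\mathbf a\in\Psi$ if and only if $c=1$. Operators: $V_\Psi$ is the vector space (here over $\mathbb{C}$) with basis $\{b_{\mathbf v}:\mathbf v\in\Psi\}$. For $\mathbf a\in\Delta$ the linear endomorphisms $E_{\mathbf a},F_{\mathbf a},H_{\mathbf a}$ of $V_\Psi$ are defined by: $E_{\mathbf a}(b_{\mathbf v})=b_{\mathbf v+\mathbf a}$ if $\mathbf v+\mathbf a\in\Psi$ and $0$ otherwise; $F_{\mathbf a}(b_{\mathbf v})=b_{\mathbf v-\mathbf a}$ if $\mathbf v-\mathbf a\in\Psi$ and $0$ otherwise; $H_{\mathbf a}(b_{\mathbf v})=c(\mathbf v,\mathbf a)\,b_{\mathbf v}$. Lie algebras: the generalized Cartan matrix of $\Delta$ is $A_{\mathbf a,\mathbf b}=2\frac{\mathbf a\cdot\mathbf b}{\mathbf a\cdot\mathbf a}$ ($\mathbf a,\mathbf b\in\Delta$). For a symmetrizable generalized Cartan matrix $A$, the derived Kac--Moody algebra $\mathfrak g'(A)$ is the Lie algebra over $\mathbb{C}$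 generated by $e_i,f_i,h_i$ subject to $[h_i,h_j]=0$, $[h_i,e_j]=A_{ij}e_j$, $[h_i,f_j]=-A_{ij}f_j$, $[e_i,f_j]=\delta_{ij}h_i$, and, for $i\ne j$, $(\mathrm{ad}\,e_i)^{1-A_{ij}}(e_j)=0=(\mathrm{ad}\,f_i)^{1-A_{ij}}(f_j)$; when $A$ is an (indecomposable) Cartan matrix of finite type this is the simple Lie algebra of that type. All module structures asserted are those in which the matrix of the indicated simple system is a generalized Cartan matrix of the stated type (up to labelling; types as in Kac's book) and the generators $e_{\mathbf a},f_{\mathbf a},h_{\mathbf a}$ act by $E_{\mathbf a},F_{\mathbf a},H_{\mathbf a}$. A weight vector (simultaneous eigenvector for all $h_i$) is a highest (respectively lowest) weight vector if it is annihilated by all $e_i$ (respectively all $f_i$). *)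

(* Defs.v *)
From HB Require Import structures.
From mathcomp Require Import all_boot all_order all_algebra finmap.
From mathcomp Require Import generic_quotient boolp reals complex.

Set Implicit Arguments.
Unset Strict Implicit.
Unset Printing Implicit Defensive.

Import Order.TTheory GRing.Theory Num.Theory.
Local Open Scope fset_scope.
Local Open Scope ring_scope.

HB.mixin Record Lmodule_isLieAlgebra (K : fieldType) L of GRing.Lmodule K L := {
  lie : L -> L -> L;
  lie_linearl : forall y, linear (fun x => lie x y);
  lie_linearr : forall x, linear (lie x);
  liexx : forall x, lie x x = 0;
  lie_jacobi : forall x y z,
    lie x (lie y z) + lie y (lie z x) + lie z (lie x y) = 0
}.

#[short(type="lieAlgType")]
HB.structure Definition LieAlgebra (K : fieldType) :=
  { L of Lmodule_isLieAlgebra K L & GRing.Lmodule K L }.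

Definition lie_morphism (K : fieldType) (L M : lieAlgType K) (f : L -> M) :=
  linear f /\ forall x y, f (lie x y) = lie (f x) (f y).

Section Modules.
Variables (K : fieldType) (L : lieAlgType K).

Definition lie_module (V : lmodType K) (rho : L -> V -> V) : Prop :=
  [/\ forall v, linear (fun x => rho x v),
      forall x, linear (rho x) &
      forall x y v, rho (lie x y) v = rho x (rho y v) - rho y (rho x v)].

Definition irreducible_module (V : lmodType K) (rho : L -> V -> V) : Prop :=
  (exists v : V, v != 0) /\
  forall U : {pred V}, submod_closed U ->
    (forall x v, v \in U -> rho x v \in U) ->
    (forall v, v \in U -> v = 0) \/ (forall v, v \in U).

Definition trivial_module (V : lmodType K) (rho : L -> V -> V) : Prop :=
  forall x v, rho x v = 0.

Definition isomorphic_modules (V W : lmodType K)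
    (rho : L -> V -> V) (tau : L -> W -> W) : Prop :=
  exists f : V -> W,
    [/\ linear f, bijective f & forall x v, f (rho x v) = tau x (f v)].

End Modules.

(* The presented algebra is the quotient of the formal Lie expressions in the
    generators by the least congruence containing the Lie algebra axioms and
    identifying each relator with 0. *)

Inductive lterm (K X : Type) : Type :=
| LGen of X
| LZero
| LAdd of lterm K X & lterm K X
| LScale of K & lterm K X
| LLie of lterm K X & lterm K X.
Arguments LZero {K X}.
Arguments LGen {K X}.

HB.instance Definition _ (K X : Type) := gen_eqMixin (lterm K X).
HB.instance Definition _ (K X : Type) := gen_choiceMixin (lterm K X).

Section Presentation.
Variables (K : fieldType) (X : Type) (rel : lterm K X -> Prop).
Local Notation T := (lterm K X).

Inductive lcongr : T -> T -> Prop :=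
| lc_rel t : rel t -> lcongr t LZero
| lc_refl t : lcongr t t
| lc_sym s t : lcongr s t -> lcongr t s
| lc_trans s t u : lcongr s t -> lcongr t u -> lcongr s u
| lc_add s s' t t' : lcongr s s' -> lcongr t t' ->
    lcongr (LAdd s t) (LAdd s' t')
| lc_scale c t t' : lcongr t t' -> lcongr (LScale c t) (LScale c t')
| lc_lie s s' t t' : lcongr s s' -> lcongr t t' ->
    lcongr (LLie s t) (LLie s' t')
| lc_addA s t u : lcongr (LAdd s (LAdd t u)) (LAdd (LAdd s t) u)
| lc_addC s t : lcongr (LAdd s t) (LAdd t s)
| lc_add0 t : lcongr (LAdd LZero t) t
| lc_addN t : lcongr (LAdd (LScale (-1) t) t) LZero
| lc_scaleA c d t : lcongr (LScale c (LScale d t)) (LScale (c * d) t)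
| lc_scale1 t : lcongr (LScale 1 t) t
| lc_scaleDr c s t :
    lcongr (LScale c (LAdd s t)) (LAdd (LScale c s) (LScale c t))
| lc_scaleDl c d t :
    lcongr (LScale (c + d) t) (LAdd (LScale c t) (LScale d t))
| lc_lieDl s t u : lcongr (LLie (LAdd s t) u) (LAdd (LLie s u) (LLie t u))
| lc_lieZl c t u : lcongr (LLie (LScale c t) u) (LScale c (LLie t u))
| lc_lieDr s t u : lcongr (LLie u (LAdd s t)) (LAdd (LLie u s) (LLie u t))
| lc_lieZr c t u : lcongr (LLie u (LScale c t)) (LScale c (LLie u t))
| lc_liexx t : lcongr (LLie t t) LZero
| lc_jacobi s t u :
    lcongr (LAdd (LAdd (LLie s (LLie t u)) (LLie t (LLie u s)))
                 (LLie u (LLie s t))) LZero.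

Definition lcongrb : T -> T -> bool := fun s t => `[< lcongr s t >].

Lemma lcongrb_refl : reflexive lcongrb.
Proof. by move=> t; apply/asboolP; apply: lc_refl. Qed.
Lemma lcongrb_sym : symmetric lcongrb.
Proof. by move=> s t; apply/asboolP/asboolP; apply: lc_sym. Qed.
Lemma lcongrb_trans : transitive lcongrb.
Proof.
by move=> t s u /asboolP st /asboolP tu; apply/asboolP; apply: lc_trans st tu.
Qed.
Canonical lcongr_equiv := EquivRel lcongrb lcongrb_refl lcongrb_sym lcongrb_trans.

Definition presented := {eq_quot lcongrb}%qT.
HB.instance Definition _ := Choice.on presented.

Definition lclass (t : T) : presented := (\pi_presented t)%qT.

Lemma lclassP s t : lclass s = lclass t <-> lcongr s t.
Proof.
by split=> [/eqquotP/asboolP | st]; last by apply/eqquotP/asboolP.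
Qed.

Lemma lclass_ind (P : presented -> Prop) : (forall t, P (lclass t)) -> forall x, P x.
Proof. by move=> Pt x; rewrite -[x]reprK; apply: Pt. Qed.

Lemma repr_lclass t : lcongr (repr (lclass t)) t.
Proof. by apply/lclassP; rewrite /lclass reprK. Qed.

Definition padd (x y : presented) := lclass (LAdd (repr x) (repr y)).
Definition popp (x : presented) := lclass (LScale (-1) (repr x)).
Definition pscale c (x : presented) := lclass (LScale c (repr x)).
Definition plie (x y : presented) := lclass (LLie (repr x) (repr y)).

Lemma paddE s t : padd (lclass s) (lclass t) = lclass (LAdd s t).
Proof. by apply/lclassP; apply: lc_add; apply: repr_lclass. Qed.
Lemma poppE t : popp (lclass t) = lclass (LScale (-1) t).
Proof. by apply/lclassP; apply: lc_scale; apply: repr_lclass. Qed.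
Lemma pscaleE c t : pscale c (lclass t) = lclass (LScale c t).
Proof. by apply/lclassP; apply: lc_scale; apply: repr_lclass. Qed.
Lemma plieE s t : plie (lclass s) (lclass t) = lclass (LLie s t).
Proof. by apply/lclassP; apply: lc_lie; apply: repr_lclass. Qed.

Lemma paddA : associative padd.
Proof.
elim/lclass_ind=> s; elim/lclass_ind=> t; elim/lclass_ind=> u.
by rewrite !paddE; apply/lclassP; apply: lc_addA.
Qed.
Lemma paddC : commutative padd.
Proof.
elim/lclass_ind=> s; elim/lclass_ind=> t.
by rewrite !paddE; apply/lclassP; apply: lc_addC.
Qed.
Lemma padd0 : left_id (lclass LZero) padd.
Proof. by elim/lclass_ind=> t; rewrite paddE; apply/lclassP; apply: lc_add0. Qed.
Lemma paddN : left_inverse (lclass LZero) popp padd.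
Proof.
by elim/lclass_ind=> t; rewrite poppE paddE; apply/lclassP; apply: lc_addN.
Qed.
HB.instance Definition _ :=
  GRing.isZmodule.Build presented paddA paddC padd0 paddN.

Lemma lclass0 : lclass LZero = 0. Proof. by []. Qed.
Lemma lclassD s t : lclass (LAdd s t) = lclass s + lclass t.
Proof. by rewrite -paddE. Qed.

Lemma pscaleA c d x : pscale c (pscale d x) = pscale (c * d) x.
Proof.
by elim/lclass_ind: x => t; rewrite !pscaleE; apply/lclassP; apply: lc_scaleA.
Qed.
Lemma pscale1 : left_id 1 pscale.
Proof.
by elim/lclass_ind=> t; rewrite pscaleE; apply/lclassP; apply: lc_scale1.
Qed.
Lemma pscaleDr : right_distributive pscale +%R.
Proof.
move=> c; elim/lclass_ind=> s; elim/lclass_ind=> t.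
by rewrite -lclassD !pscaleE -lclassD; apply/lclassP; apply: lc_scaleDr.
Qed.
Lemma pscaleDl x : {morph pscale^~ x : c d / c + d}.
Proof.
elim/lclass_ind: x => t c d.
by rewrite !pscaleE -lclassD; apply/lclassP; apply: lc_scaleDl.
Qed.
HB.instance Definition _ := GRing.Zmodule_isLmodule.Build K presented
  pscaleA pscale1 pscaleDr pscaleDl.

Lemma lclassZ c t : lclass (LScale c t) = c *: lclass t.
Proof. by rewrite -pscaleE. Qed.

Lemma plie_linearl y : linear (fun x => plie x y).
Proof.
elim/lclass_ind: y => u c; elim/lclass_ind=> s; elim/lclass_ind=> t.
rewrite -lclassZ -lclassD !plieE -lclassZ -lclassD; apply/lclassP.
by apply: lc_trans (lc_lieDl _ _ _) _; apply: lc_add (lc_lieZl _ _ _) (lc_refl _).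
Qed.
Lemma plie_linearr x : linear (plie x).
Proof.
elim/lclass_ind: x => u c; elim/lclass_ind=> s; elim/lclass_ind=> t.
rewrite -lclassZ -lclassD !plieE -lclassZ -lclassD; apply/lclassP.
by apply: lc_trans (lc_lieDr _ _ _) _; apply: lc_add (lc_lieZr _ _ _) (lc_refl _).
Qed.
Lemma pliexx x : plie x x = 0.
Proof. by elim/lclass_ind: x => t; rewrite plieE; apply/lclassP; apply: lc_liexx. Qed.
Lemma plie_jacobi x y z :
  plie x (plie y z) + plie y (plie z x) + plie z (plie x y) = 0.
Proof.
elim/lclass_ind: x => s; elim/lclass_ind: y => t; elim/lclass_ind: z => u.
by rewrite !plieE -!lclassD; apply/lclassP; apply: lc_jacobi.
Qed.
HB.instance Definition _ := Lmodule_isLieAlgebra.Build K presented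
  plie_linearl plie_linearr pliexx plie_jacobi.

Lemma lclass_lie s t : lclass (LLie s t) = lie (lclass s) (lclass t).
Proof. by rewrite -plieE. Qed.

Lemma lclass_rel t : rel t -> lclass t = 0.
Proof. by move=> rt; apply/lclassP/lc_rel. Qed.

Fixpoint leval (L : lieAlgType K) (g : X -> L) (t : T) : L :=
  match t with
  | LGen x => g x
  | LZero => 0
  | LAdd s t => leval g s + leval g t
  | LScale c t => c *: leval g t
  | LLie s t => lie (leval g s) (leval g t)
  end.

Lemma leval_lclass t : leval (fun x => lclass (LGen x)) t = lclass t.
Proof.
elim: t => //= [s -> t ->|c t ->|s -> t ->].
- by rewrite lclassD.
- by rewrite lclassZ.
- by rewrite lclass_lie.
Qed.

Lemma lieDl (L : lieAlgType K) (x y z : L) : lie (x + y) z = lie x z + lie y z.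
Proof. by have := lie_linearl z 1 x y; rewrite !scale1r. Qed.
Lemma lieDr (L : lieAlgType K) (x y z : L) : lie z (x + y) = lie z x + lie z y.
Proof. by have := lie_linearr z 1 x y; rewrite !scale1r. Qed.
Lemma lie0l (L : lieAlgType K) (z : L) : lie 0 z = 0.
Proof. by have /eqP := lieDl 0 0 z; rewrite addr0 -subr_eq subrr => /eqP. Qed.
Lemma lie0r (L : lieAlgType K) (z : L) : lie z 0 = 0.
Proof. by have /eqP := lieDr 0 0 z; rewrite addr0 -subr_eq subrr => /eqP. Qed.
Lemma lieZl (L : lieAlgType K) c (x z : L) : lie (c *: x) z = c *: lie x z.
Proof. by have := lie_linearl z c x 0; rewrite lie0l !addr0. Qed.
Lemma lieZr (L : lieAlgType K) c (x z : L) : lie z (c *: x) = c *: lie z x.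
Proof. by have := lie_linearr z c x 0; rewrite lie0r !addr0. Qed.

Lemma leval_congr (L : lieAlgType K) (g : X -> L) s t :
  (forall r, rel r -> leval g r = 0) -> lcongr s t -> leval g s = leval g t.
Proof.
move=> grel; elim=> //=.
- by move=> ? ? ? _ -> _ ->.
- by move=> ? ? ? ? _ -> _ ->.
- by move=> ? ? ? _ ->.
- by move=> ? ? ? ? _ -> _ ->.
- by move=> ? ? ?; rewrite addrA.
- by move=> ? ?; rewrite addrC.
- by move=> ?; rewrite add0r.
- by move=> ?; rewrite scaleN1r addNr.
- by move=> ? ? ?; rewrite scalerA.
- by move=> ?; rewrite scale1r.
- by move=> ? ? ?; rewrite scalerDr.
- by move=> ? ? ?; rewrite scalerDl.
- by move=> ? ? ?; rewrite lieDl.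
- by move=> ? ? ?; rewrite lieZl.
- by move=> ? ? ?; rewrite lieDr.
- by move=> ? ? ?; rewrite lieZr.
- by move=> ?; rewrite liexx.
- by move=> ? ? ?; rewrite lie_jacobi.
Qed.

Lemma presented_universal (L : lieAlgType K) (g : X -> L) :
  (forall r, rel r -> leval g r = 0) ->
  exists! f : presented -> L,
    lie_morphism f /\ forall x, f (lclass (LGen x)) = g x.
Proof.
move=> grel; pose f (x : presented) := leval g (repr x).
have fE t : f (lclass t) = leval g t.
  by apply: leval_congr (repr_lclass t).
exists f; split=> [|h [[hlin hlie] hg]].
  split=> [|x]; last by rewrite fE.
  split=> [c|]; elim/lclass_ind=> s; elim/lclass_ind=> t.
    by rewrite -lclassZ -lclassD !fE.
  by rewrite -lclass_lie !fE.
have h0 : h 0 = 0.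
  by have /eqP := hlin 1 0 0; rewrite !scale1r addr0 -subr_eq subrr => /eqP.
apply: functional_extensionality_dep; elim/lclass_ind => t; rewrite fE.
elim: t => [x||s IHs t IHt|c t IHt|s IHs t IHt] /=.
- by rewrite hg.
- by rewrite lclass0 h0.
- rewrite lclassD IHs IHt; have := hlin 1 (lclass s) (lclass t).
  by rewrite !scale1r.
- by rewrite lclassZ IHt; have := hlin c (lclass t) 0; rewrite h0 !addr0.
- by rewrite lclass_lie hlie IHs IHt.
Qed.

End Presentation.

Inductive chevalley_gen (n : nat) : Type :=
| GenE of 'I_n | GenF of 'I_n | GenH of 'I_n.

Section KacMoody.
Variables (K : fieldType) (n : nat) (A : 'M[int]_n).

Local Notation e i := (LGen (GenE i)).
Local Notation f i := (LGen (GenF i)).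
Local Notation h i := (LGen (GenH i)).
Local Notation "[ x , y ]" := (LLie x y).
Local Notation LSub s t := (LAdd s (LScale (-1) t)).

(* For a generalized Cartan matrix 1 - A i j > 0 when i != j, so that [absz]
   does not change the exponent in the Serre relations. *)
Inductive km_rel : lterm K (chevalley_gen n) -> Prop :=
| km_hh i j : km_rel [h i, h j]
| km_he i j : km_rel (LSub [h i, e j] (LScale (A i j)%:~R (e j)))
| km_hf i j : km_rel (LSub [h i, f j] (LScale (- (A i j)%:~R) (f j)))
| km_ef i j : km_rel (LSub [e i, f j] (LScale (i == j)%:R (h i)))
| km_serre_e i j : i != j ->
    km_rel (iter (absz (1 - A i j)) (fun x => [e i, x]) (e j))
| km_serre_f i j : i != j ->
    km_rel (iter (absz (1 - A i j)) (fun x => [f i, x]) (f j)).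

Definition derived_km : lieAlgType K := presented km_rel.

Definition km_e i : derived_km := lclass km_rel (e i).
Definition km_f i : derived_km := lclass km_rel (f i).
Definition km_h i : derived_km := lclass km_rel (h i).

Definition weight_vector (V : lmodType K) (rho : derived_km -> V -> V) (v : V) :=
  v != 0 /\ forall i, exists c : K, rho (km_h i) v = c *: v.

Definition highest_weight_vector (V : lmodType K) (rho : derived_km -> V -> V)
    (v : V) :=
  weight_vector rho v /\ forall i, rho (km_e i) v = 0.

Definition lowest_weight_vector (V : lmodType K) (rho : derived_km -> V -> V)
    (v : V) :=
  weight_vector rho v /\ forall i, rho (km_f i) v = 0.

End KacMoody.

(* The nodes of E7^(1) and E6^(1) are
    numbered as in Kac's tables; node [i] of [cartan_E7] and [cartan_E6] is
    Kac's node [i + 1]. *)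

Definition simply_laced (n : nat) (edges : seq (nat * nat)) : 'M[int]_n :=
  \matrix_(i < n, j < n)
    if i == j then 2
    else if ((i : nat, j : nat) \in edges) || ((j : nat, i : nat) \in edges)
    then -1 else 0.

Definition cartan_E6 : 'M[int]_6 :=
  simply_laced 6 [:: (0, 1); (1, 2); (2, 3); (3, 4); (2, 5)]%N.
Definition cartan_E7 : 'M[int]_7 :=
  simply_laced 7 [:: (0, 1); (1, 2); (2, 3); (3, 4); (4, 5); (2, 6)]%N.
Definition cartan_E6_1 : 'M[int]_7 :=
  simply_laced 7 [:: (1, 2); (2, 3); (3, 4); (4, 5); (3, 6); (6, 0)]%N.
Definition cartan_E7_1 : 'M[int]_8 :=
  simply_laced 8
    [:: (0, 1); (1, 2); (2, 3); (3, 4); (4, 5); (5, 6); (3, 7)]%N.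

Section Minuscule.
Variables (R : realType) (n : nat).
Implicit Types (u v a b : 'rV[R]_n) (Psi Delta : {fset 'rV[R]_n}).

Definition dot u v : R := \sum_i u 0 i * v 0 i.

Definition minuscule Psi Delta : Prop :=
  0 \notin Delta /\
  forall v a, v \in Psi -> a \in Delta ->
    exists2 c : R, c \in [:: -1; 0; 1] &
      [/\ 2 * dot v a = c * dot a a,
          v + a \in Psi <-> c = -1 &
          v - a \in Psi <-> c = 1].

(* [sigma] labels [Delta] so that its Cartan matrix becomes [A]. *)
Definition cartan_labelling m (A : 'M[int]_m) Delta (sigma : 'I_m -> Delta) :=
  bijective sigma /\
  forall i j, (A i j)%:~R =
    2 * (dot (val (sigma i)) (val (sigma j)) /
         dot (val (sigma i)) (val (sigma i))).

Definition of_type m (A : 'M[int]_m) Delta : Prop :=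
  exists sigma : 'I_m -> Delta, cartan_labelling A sigma.

(* When [a != 0] this is the only possible c in [minuscule]. *)
Definition coef v a : R := 2 * dot v a / dot a a.

Local Notation C := R[i].

Definition minV Psi : vectType C := {ffun Psi -> C^o}.

Variable Psi : {fset 'rV[R]_n}.

(* Only meant for [w \in Psi]; it is 0 otherwise. *)
Definition bvec (w : 'rV[R]_n) : minV Psi := [ffun v : Psi => (val v == w)%:R].

Definition opE a (x : minV Psi) : minV Psi :=
  \sum_(v : Psi)
    x v *: (if val v + a \in Psi then bvec (val v + a) else 0).

Definition opF a (x : minV Psi) : minV Psi :=
  \sum_(v : Psi)
    x v *: (if val v - a \in Psi then bvec (val v - a) else 0).

Definition opH a (x : minV Psi) : minV Psi :=
  \sum_(v : Psi) x v *: ((coef (val v) a)%:C%C *: bvec (val v)).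

Definition minuscule_module m (A : 'M[int]_m) Delta (sigma : 'I_m -> Delta)
    (rho : derived_km C A -> minV Psi -> minV Psi) : Prop :=
  lie_module rho /\
  forall i, [/\ rho (km_e C A i) =1 opE (val (sigma i)),
                rho (km_f C A i) =1 opF (val (sigma i)) &
                rho (km_h C A i) =1 opH (val (sigma i))].

End Minuscule.

Arguments bvec {R n} Psi w.

Section FiftySix.
Variable R : realType.

Definition eps (k : nat) : 'rV[R]_8 := \row_j (j == k :> nat)%:R.

Definition vv (i j : nat) : 'rV[R]_8 :=
  4 *: (eps i + eps j) - \sum_(k < 8) eps k.

Definition Psi56 : {fset 'rV[R]_8} :=
  let P := [fset vv i j | i in iota 0 8, j in iota 0 8 & (i < j)%N] in
  P `|` [fset - v | v in P].

Definition alpha (i : nat) : 'rV[R]_8 :=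
  if (i < 7)%N then 4 *: (eps i - eps i.+1)
  else \row_(j < 8) (if (j < 4)%N then -2 else 2).

Definition Delta8 : {fset 'rV[R]_8} := [fset alpha i | i in iota 0 8].

Definition level (n : 'rV[R]_8) (l : R) : {fset 'rV[R]_8} :=
  [fset v in Psi56 | dot v n == l].

Definition orth_simple (n : 'rV[R]_8) : {fset 'rV[R]_8} :=
  [fset a in Delta8 | dot a n == 0].

End FiftySix.

Arguments eps {R} k.
Arguments vv {R} i j.
Arguments Psi56 {R}.
Arguments alpha {R} i.
Arguments Delta8 {R}.

(* Main.v *)
Require Import Defs.
From HB Require Import structures.
From mathcomp Require Import all_boot all_order all_algebra finmap.
From mathcomp Require Import boolp reals complex.
From mathcomp Require Import ssrAC ring lra.

Set Implicit Arguments.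
Unset Strict Implicit.
Unset Printing Implicit Defensive.

Import Order.TTheory GRing.Theory Num.Theory.
Local Open Scope fset_scope.
Local Open Scope ring_scope.

(** Let [Psi] be minuscule with respect to [Delta]. The operators [E_a], [F_a],
    [H_a] satisfy the defining relations of the derived Kac--Moody algebra
    because strings through a root have at most two elements: if [v], [v + a]
    and [v + 2 a] were all in [Psi], the coefficients of the first two at [a]
    would be -1 and 1, but the second one has to be -1. Hence [E_a] squares to 0,
    its adjoint action cubes to 0, and the Serre relations reduce to the
    commutation of [E_a] and [E_b] for orthogonal [a], [b] and to
    [E_a E_b E_a = 0] when the Cartan integer is -1; together with
    [[E_a, F_b] = 0] they follow from the linearity of the coefficient in [v].
    So every labelling of [Delta] by a matrix with nonpositive off-diagonal
    entries yields a module ([minuscule_module_exists]).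

    Such a module is irreducible ([minuscule_irreducible]) if the weights
    separate [Psi] and [Psi] has a unique maximal element. A nonzero submodule
    then contains a basis vector, which is raised to the maximal one, from which
    all others are recovered by lowering. An isomorphism of modules preserves
    weights, so two modules are not isomorphic if a weight of one does not occur
    in the other ([not_isomorphic_weight]).

    Minusculeness passes to smaller simple systems and to level sets of a
    functional that vanishes on the simple system. All the systems at hand are
    therefore obtained from the 56 vectors and the nine roots [alpha_0], ...,
    [alpha_7], [4 (epsilon_0 - epsilon_7)], and what remains is a finite
    verification in integer coordinates ([minuscule56]), which also gives the
    Cartan types, the cardinalities and the extremal weights. *)

(** * The Lie algebra of endomorphisms *)

(** The general linear Lie algebra: endomorphisms with the commutator. *)
Definition gl (K : fieldType) (V : vectType K) := 'End(V).

Section GeneralLinear.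
Variables (K : fieldType) (V : vectType K).
HB.instance Definition _ := GRing.Lmodule.on (gl V).

Definition gl_lie (f g : gl V) : gl V := (f \o g)%VF - (g \o f)%VF.

Lemma gl_lieE (f g : gl V) v : gl_lie f g v = f (g v) - g (f v).
Proof. by rewrite /gl_lie add_lfunE opp_lfunE !comp_lfunE. Qed.

Lemma gl_lie_linearl g : linear (fun f => gl_lie f g).
Proof.
move=> c f f'; apply/lfunP => v; rewrite !(gl_lieE, add_lfunE, scale_lfunE).
by rewrite linearP scalerBr opprD addrACA.
Qed.

Lemma gl_lie_linearr f : linear (gl_lie f).
Proof.
move=> c g g'; apply/lfunP => v; rewrite !(gl_lieE, add_lfunE, scale_lfunE).
by rewrite linearP scalerBr opprD addrACA.
Qed.

Lemma gl_liexx f : gl_lie f f = 0.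
Proof. exact: subrr. Qed.

Lemma gl_lie_jacobi f g h :
  gl_lie f (gl_lie g h) + gl_lie g (gl_lie h f) + gl_lie h (gl_lie f g) = 0.
Proof.
apply/lfunP => v; rewrite !(add_lfunE, gl_lieE) !linearB zero_lfunE /=.
set a := f _; set b := f _; set c := g _; set d := h _.
set e := g (h (f v)); set i := h (g (f v)).
rewrite !opprK !addrA.
rewrite [LHS](ACl ((1*11)*(2*8)*(3*5)*(4*10)*(6*12)*(7*9))).
by rewrite /= !(subrr, addNr) !addr0.
Qed.

HB.instance Definition _ := Lmodule_isLieAlgebra.Build K (gl V)
  gl_lie_linearl gl_lie_linearr gl_liexx gl_lie_jacobi.

End GeneralLinear.

(** * Coefficients and strings of roots *)

Section Dot.
Variables (R : realType) (n : nat).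
Implicit Types u v w : 'rV[R]_n.

Lemma dotC u v : dot u v = dot v u.
Proof. by apply: eq_bigr => i _; rewrite mulrC. Qed.

Lemma dotDl u v w : dot (u + v) w = dot u w + dot v w.
Proof. by rewrite -big_split; apply: eq_bigr => i _; rewrite mxE mulrDl. Qed.

Lemma dotNl u v : dot (- u) v = - dot u v.
Proof. by rewrite -sumrN; apply: eq_bigr => i _; rewrite mxE mulNr. Qed.

Lemma dotNr u v : dot u (- v) = - dot u v.
Proof. by rewrite !(dotC u) dotNl. Qed.

Lemma dot_eq0 u : (dot u u == 0) = (u == 0).
Proof.
apply/eqP/eqP => [|->]; last by rewrite /dot big1 // => i _; rewrite mxE mul0r.
move=> /eqP; rewrite psumr_eq0 => [|i _]; last by rewrite -expr2 sqr_ge0.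
move=> /allP u0; apply/rowP => i; rewrite mxE; apply/eqP.
by have := u0 i (mem_index_enum i); rewrite mulf_eq0 orbb.
Qed.

Lemma coefDl u v w : coef (u + v) w = coef u w + coef v w.
Proof. by rewrite /coef dotDl mulrDr mulrDl. Qed.

Lemma coefNl u v : coef (- u) v = - coef u v.
Proof. by rewrite /coef dotNl mulrN mulNr. Qed.

Lemma coefNr u v : coef u (- v) = - coef u v.
Proof. by rewrite /coef dotNr dotNl dotNr opprK mulrN mulNr. Qed.

Lemma coefxx u : u != 0 -> coef u u = 2.
Proof. by rewrite -dot_eq0 /coef => u0; rewrite mulfK. Qed.

Lemma coef_eq0C u v : u != 0 -> coef v u = 0 -> coef u v = 0.
Proof.
move=> u0 /eqP; rewrite /coef !mulf_eq0 invr_eq0 dot_eq0 (negPf u0) pnatr_eq0.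
by rewrite orbF dotC => /eqP ->; rewrite mulr0 mul0r.
Qed.

End Dot.

Section Strings.
Variables (R : realType) (n : nat) (Psi Delta : {fset 'rV[R]_n}).
Implicit Types u v w a b : 'rV[R]_n.

(** The part of minusculeness that a single root [a] has to satisfy, in a form
    that is symmetric under exchanging [a] and [- a]. *)
Definition minuscule_root a :=
  a != 0 /\ forall v, v \in Psi ->
    [/\ coef v a \in [:: -1; 0; 1], (v + a \in Psi) = (coef v a == -1)
      & (v - a \in Psi) = (coef v a == 1)].

Lemma minuscule_rootP a : minuscule Psi Delta -> a \in Delta -> minuscule_root a.
Proof.
move=> [D0 minP] aD; have a0 : a != 0 by apply: contraNneq D0 => <-.
split=> // v vP; have [c cs [cE pE mE]] := minP v a vP aD.
have -> : coef v a = c by rewrite /coef cE mulfK // dot_eq0.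
by split=> //; [apply/idP/eqP => /pE | apply/idP/eqP => /mE].
Qed.

Lemma minuscule_rootN a : minuscule_root a -> minuscule_root (- a).
Proof.
move=> [a0 aP]; split=> [|v /aP[c1 pE mE]]; first by rewrite oppr_eq0.
rewrite coefNr opprK pE mE !eqr_oppLR opprK; split=> //.
by move: c1; rewrite !inE !eqr_oppLR oppr0 opprK => /or3P[] ->; rewrite ?orbT.
Qed.

Variable a : 'rV[R]_n.
Hypothesis am : minuscule_root a.

Lemma coef_ge v : v \in Psi -> -1 <= coef v a.
Proof. by move=> /(am.2)[+ _ _]; rewrite !inE => /or3P[] /eqP ->; lra. Qed.

Lemma addr_in v : v \in Psi -> (v + a \in Psi) = (coef v a == -1).
Proof. by case/(am.2). Qed.

Lemma subr_in v : v \in Psi -> (v - a \in Psi) = (coef v a == 1).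
Proof. by case/(am.2). Qed.

(** Strings through [a] have length at most two. *)
Lemma addr_twice v : v \in Psi -> v + a \in Psi -> v + a + a \notin Psi.
Proof.
move=> vP vaP; rewrite addr_in // coefDl coefxx ?am.1 //.
by move: vaP; rewrite addr_in // => /eqP ->; apply/eqP => ?; lra.
Qed.

Lemma addr_string b v : minuscule_root b -> coef b a <= 0 ->
    v \in Psi -> v - b \in Psi -> v - b + a \in Psi -> v + a \in Psi.
Proof.
move=> bm ab vP vbP; rewrite addr_in // addr_in // coefDl coefNl => /eqP ca.
by apply/eqP; have := coef_ge vP; lra.
Qed.

(** For roots with [coef b a = 0] the order of two steps is irrelevant. *)
Lemma addr_comm b v : coef b a = 0 ->
  v \in Psi -> v + b \in Psi -> v + b + a \in Psi -> v + a \in Psi.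
Proof.
by move=> ab vP vbP; rewrite addr_in // addr_in // coefDl ab addr0.
Qed.

(** [v + 2 a + b] can be reached through [v + a] only if [coef b a = -2]. *)
Lemma addr_serre b v : coef b a != -2 -> v \in Psi -> v + a \in Psi ->
  v + a + b \in Psi -> v + a + b + a \notin Psi.
Proof.
move=> ab vP vaP vabP; rewrite addr_in // !coefDl coefxx ?am.1 //.
move: vaP; rewrite addr_in // => /eqP ->; apply: contraNneq ab => ?.
by apply/eqP; lra.
Qed.

End Strings.

Section SubSystems.
Variables (R : realType) (n : nat) (Psi Delta : {fset 'rV[R]_n}).

Lemma minusculeS (Delta' : {fset 'rV[R]_n}) :
  {subset Delta' <= Delta} -> minuscule Psi Delta -> minuscule Psi Delta'.
Proof.
move=> sD [D0 minP]; split; first by apply: contraNN D0; apply: sD.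
by move=> v a vP /sD; apply: minP.
Qed.

(** A level set of a linear functional that vanishes on [Delta] is again
    minuscule. *)
Lemma minuscule_slice (Psi' : {fset 'rV[R]_n}) (m : 'rV[R]_n) (l : R) :
  (forall v, (v \in Psi') = (v \in Psi) && (dot v m == l)) ->
  (forall a, a \in Delta -> dot a m = 0) ->
  minuscule Psi Delta -> minuscule Psi' Delta.
Proof.
move=> Psi'E orth [D0 minP]; split=> // v a; rewrite Psi'E => /andP[vP /eqP vl] aD.
have [c cs [cE pE mE]] := minP v a vP aD; exists c => //.
by rewrite !Psi'E !dotDl dotNl (orth a) // oppr0 !addr0 vl eqxx !andbT.
Qed.

End SubSystems.

(** * The Kac--Moody relations *)

(** The relations between the root operators, for an arbitrary space [V] with
    a spanning family [b] indexed by [Psi] (and extended by 0). *)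
Section Relations.
Variables (R : realType) (n : nat) (Psi : {fset 'rV[R]_n}).
Local Notation C := R[i].
Variables (V : vectType C) (b : 'rV[R]_n -> V) (E H : 'rV[R]_n -> gl V).
Implicit Types (u v w a d : 'rV[R]_n) (x y : V).

Hypothesis b_out : forall w, w \notin Psi -> b w = 0.
Hypothesis b_ext : forall f g : gl V,
  (forall w, w \in Psi -> f (b w) = g (b w)) -> f = g.
Hypothesis E_b : forall a w, E a (b w) = if w \in Psi then b (w + a) else 0.
Hypothesis H_b : forall a w, H a (b w) = (coef w a)%:C%C *: b w.

Lemma gl_lieHH a d : gl_lie (H a) (H d) = 0.
Proof.
apply: b_ext => w wP; rewrite gl_lieE !H_b !linearZ /= !H_b.
by rewrite scalerN !scalerA mulrC subrr zero_lfunE.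
Qed.

Lemma gl_lieHE a d : gl_lie (H a) (E d) = (coef d a)%:C%C *: E d.
Proof.
apply: b_ext => w wP; rewrite gl_lieE H_b linearZ /= !E_b wP.
rewrite H_b -scalerBl -rmorphB scale_lfunE E_b wP.
by rewrite coefDl addrC addKr.
Qed.

Lemma gl_lieEF a : minuscule_root Psi a -> gl_lie (E a) (E (- a)) = H a.
Proof.
move=> am; apply: b_ext => w wP; rewrite gl_lieE !E_b wP !E_b.
rewrite H_b addrNK addrK (addr_in am) // (subr_in am) //.
case: (am) => _ /(_ w wP)[+ _ _]; rewrite !inE => /or3P[] /eqP ->.
- by rewrite eqxx lt_eqF ?ltrN10 ?(lt_trans (ltrN10 R)) // sub0r rmorphN1 scaleN1r.
- by rewrite lt_eqF // gt_eqF ?ltrN10 // subrr scale0r.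
- by rewrite eqxx gt_eqF ?(lt_trans (ltrN10 R)) // subr0 scale1r.
Qed.

Lemma gl_lieEF0 a d : minuscule_root Psi a -> minuscule_root Psi d ->
  coef a d <= 0 -> coef d a <= 0 -> gl_lie (E a) (E (- d)) = 0.
Proof.
move=> am dm ad da; apply: b_ext => w wP; rewrite gl_lieE !E_b wP !E_b zero_lfunE.
rewrite [w + a - d]addrAC.
have [wadP|/b_out ->] := boolP (w - d + a \in Psi); last first.
  by rewrite !if_same subrr.
have [wdP|wdP] := ifPn.
  by rewrite (addr_string am dm) // subrr.
rewrite ifN ?subrr //; apply: contraNN wdP => waP.
apply: (addr_string (minuscule_rootN dm) (minuscule_rootN am)) => //.
- by rewrite coefNl coefNr opprK.
- by rewrite opprK.
- by rewrite opprK addrAC.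
Qed.

Lemma E_sqr a x : minuscule_root Psi a -> E a (E a x) = 0.
Proof.
move=> am; suff: (E a \o E a)%VF = 0 by move/lfunP/(_ x); rewrite comp_lfunE zero_lfunE.
apply: b_ext => w wP; rewrite comp_lfunE zero_lfunE !E_b wP E_b.
by case: ifP => // waP; rewrite b_out // (addr_twice am).
Qed.

Lemma gl_lieEE0 a d : minuscule_root Psi a -> minuscule_root Psi d ->
  coef d a = 0 -> gl_lie (E a) (E d) = 0.
Proof.
move=> am dm da; have ad : coef a d = 0 by apply: coef_eq0C => //; case: am.
apply: b_ext => w wP; rewrite gl_lieE !E_b wP !E_b zero_lfunE.
rewrite [w + a + d]addrAC.
have [wadP|/b_out ->] := boolP (w + d + a \in Psi); last first.
  by rewrite !if_same subrr.
have [wdP|wdP] := ifPn.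
  by rewrite (addr_comm am da) // subrr.
rewrite ifN ?subrr //; apply: contraNN wdP => waP.
by apply: (addr_comm dm ad wP waP); rewrite addrAC.
Qed.

Lemma E_EdE a d x : minuscule_root Psi a -> coef d a != -2 ->
  E a (E d (E a x)) = 0.
Proof.
move=> am da; suff: (E a \o (E d \o E a))%VF = 0.
  by move/lfunP/(_ x); rewrite !comp_lfunE zero_lfunE.
apply: b_ext => w wP; rewrite !comp_lfunE zero_lfunE !E_b wP E_b.
case: ifP => [waP|]; last by rewrite linear0.
by rewrite E_b; case: ifP => // wadP; rewrite b_out // (addr_serre am da).
Qed.

Lemma gl_lieEEE0 a d : minuscule_root Psi a -> coef d a != -2 ->
  gl_lie (E a) (gl_lie (E a) (E d)) = 0.
Proof.
move=> am da; apply/lfunP => x; rewrite zero_lfunE !gl_lieE !linearB /=.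
by rewrite !E_EdE // !E_sqr // !(linear0, subr0, oppr0, addr0, add0r, subrr).
Qed.

(** As [E a] squares to 0, its adjoint action cubes to 0. *)
Lemma gl_lieEEEE0 a (f : gl V) : minuscule_root Psi a ->
  gl_lie (E a) (gl_lie (E a) (gl_lie (E a) f)) = 0.
Proof.
move=> am; apply/lfunP => x; rewrite zero_lfunE !gl_lieE !linearB /= !E_sqr //.
by rewrite !(linear0, subr0, oppr0, add0r, addr0).
Qed.

Lemma serre_relation a d (c : int) : minuscule_root Psi a -> minuscule_root Psi d ->
  c <= 0 -> coef d a = c%:~R -> iter `|1 - c|%N (gl_lie (E a)) (E d) = 0.
Proof.
move=> am dm; case: c => [[|k]|k] // _ da.
  exact: gl_lieEE0.
rewrite NegzE (_ : `|1 - - k.+1%:Z|%N = k.+2); last first.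
  by rewrite opprK -PoszD.
case: k da => [|k] da.
  by apply: gl_lieEEE0 => //; rewrite da; apply/eqP => ?; lra.
rewrite -addn3 iterD /= gl_lieEEEE0 //; elim: k {da} => //= k ->.
by apply/lfunP => x; rewrite gl_lieE !zero_lfunE linear0 subrr.
Qed.


(** The universal property of the presentation turns the relations into a
    module over the derived Kac--Moody algebra. *)
Theorem km_module_exists m (A : 'M[int]_m) (root : 'I_m -> 'rV[R]_n) :
    (forall i, minuscule_root Psi (root i)) ->
    (forall i j, (A i j)%:~R = coef (root j) (root i)) ->
    (forall i j, i != j -> A i j <= 0) ->
  exists rho : derived_km C A -> V -> V, lie_module rho /\
    forall i, [/\ rho (km_e C A i) =1 E (root i),
                  rho (km_f C A i) =1 E (- root i) &
                  rho (km_h C A i) =1 H (root i)].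
Proof.
move=> rm AE Ale0.
pose g (x : chevalley_gen m) : gl V := match x with
  | GenE i => E (root i) | GenF i => E (- root i) | GenH i => H (root i) end.
have coefC i j : (coef (root j) (root i))%:C%C = (A i j)%:~R :> C.
  by rewrite -AE rmorph_int.
have coef_le0 i j : i != j -> coef (root j) (root i) <= 0.
  by move=> ij; rewrite -AE lerz0 Ale0.
have rmN i := minuscule_rootN (rm i).
have iterE (x : chevalley_gen m) (t : lterm C (chevalley_gen m)) k :
    leval g (iter k (LLie (LGen x)) t) = iter k (gl_lie (g x)) (leval g t).
  by elim: k => //= k ->.
have gP r : km_rel A r -> leval g r = 0 :> gl V.
  case=> [i j|i j|i j|i j|i j ij|i j ij] /=.
  - exact: gl_lieHH.
  - by rewrite [lie _ _]gl_lieHE coefC scaleN1r subrr.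
  - by rewrite [lie _ _]gl_lieHE coefNl rmorphN /= coefC scaleN1r subrr.
  - rewrite scaleN1r; have [->|ij] := eqVneq.
      by rewrite [lie _ _]gl_lieEF // scale1r subrr.
    by rewrite [lie _ _]gl_lieEF0 ?scale0r ?subrr ?coef_le0 // eq_sym.
  - by rewrite iterE; apply: serre_relation; rewrite ?Ale0 ?AE.
  - rewrite iterE; apply: serre_relation; rewrite ?Ale0 ?AE //.
    by rewrite coefNl coefNr opprK.
have [f [[[flin flie] fg] _]] := presented_universal gP.
exists (fun s => f s : gl V); split.
  split=> [v c s t|s|s t v]; first by rewrite flin add_lfunE scale_lfunE.
    exact: linearP.
  by rewrite flie [lie _ _]/= gl_lieE.
by move=> i; split=> v; rewrite /km_e /km_f /km_h fg.
Qed.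

End Relations.

(** * The module of a minuscule system *)

Section Operators.
Variables (R : realType) (n : nat) (Psi : {fset 'rV[R]_n}).
Local Notation C := R[i].
Local Notation V := (minV Psi).
Local Notation b := (bvec Psi).
Implicit Types (u v w a c : 'rV[R]_n) (x y : V).

Lemma bvec_out w : w \notin Psi -> b w = 0.
Proof.
move=> wP; apply/ffunP => v; rewrite !ffunE.
by case: eqP => // vw; rewrite -vw fsvalP in wP.
Qed.

Lemma bvec_neq0 w : w \in Psi -> b w != 0.
Proof.
move=> wP; apply/eqP => /ffunP /(_ [` wP]) /eqP.
by rewrite !ffunE eqxx oner_eq0.
Qed.

Lemma minV_sum x : x = \sum_v x v *: b (val v).
Proof.
apply/ffunP => w; rewrite sum_ffunE (bigD1 w) //= big1 ?addr0 => [|v vw].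
  by rewrite !ffunE eqxx /GRing.scale /= mulr1.
by rewrite !ffunE (inj_eq val_inj) eq_sym (negPf vw) /GRing.scale /= mulr0.
Qed.

Lemma dim_minV : \dim {: V} = #|` Psi|.
Proof. by rewrite dimvf /dim /= muln1 cardfE. Qed.

(** The linear map out of [V] with prescribed values on the basis [bvec]. *)
Definition coordmap (W : lmodType C) (g : Psi -> W) x : W := \sum_v x v *: g v.

Lemma coordmap_linear (W : lmodType C) (g : Psi -> W) : linear (coordmap g).
Proof.
move=> k x y; rewrite scaler_sumr -big_split; apply: eq_bigr => v _ /=.
by rewrite !ffunE scalerDl scalerA.
Qed.
HB.instance Definition _ (W : lmodType C) (g : Psi -> W) :=
  GRing.isLinear.Build C V W *:%R (coordmap g) (coordmap_linear g).

Lemma coordmap_bvec (W : lmodType C) (g : Psi -> W) w (wP : w \in Psi) :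
  coordmap g (b w) = g [` wP].
Proof.
rewrite /coordmap (bigD1 [` wP]) //= ffunE eqxx scale1r big1 ?addr0 // => v vw.
rewrite ffunE; case: eqP => [vE|]; last by rewrite scale0r.
by case/eqP: vw; apply: val_inj.
Qed.

Lemma gl_eq (f g : gl V) : (forall w, w \in Psi -> f (b w) = g (b w)) -> f = g.
Proof.
move=> fg; apply/lfunP => x; rewrite (minV_sum x) !linear_sum.
by apply: eq_bigr => v _; rewrite !linearZ /= fg ?fsvalP.
Qed.

(** [opE], [opF] and [opH] as elements of the Lie algebra [gl V]; as
    [opF a] is the same as [opE (- a)], it needs no separate treatment. *)
Definition glE a : gl V := linfun (coordmap (fun v : Psi => b (val v + a))).
Definition glH a : gl V :=
  linfun (coordmap (fun v : Psi => (coef (val v) a)%:C%C *: b (val v))).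

Lemma glE_opE a : glE a =1 opE a.
Proof.
move=> x; rewrite lfunE; apply: eq_bigr => v _.
by congr (_ *: _); case: ifP => // /negbT /bvec_out->.
Qed.

Lemma glE_opF a : glE (- a) =1 opF a.
Proof. by move=> x; rewrite glE_opE. Qed.

Lemma glH_opH a : glH a =1 opH a.
Proof. by move=> x; rewrite lfunE. Qed.

Lemma glE_bvec a w : glE a (b w) = if w \in Psi then b (w + a) else 0.
Proof.
rewrite lfunE /=; case: ifPn => [wP|/bvec_out ->]; last exact: linear0.
by rewrite coordmap_bvec.
Qed.

Lemma glH_bvec a w : glH a (b w) = (coef w a)%:C%C *: b w.
Proof.
rewrite lfunE /=; have [wP|/bvec_out ->] := boolP (w \in Psi).
  by rewrite coordmap_bvec.
by rewrite scaler0 linear0.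
Qed.

(** A minuscule system is a module for the derived Kac--Moody algebra of any
    labelling of its simple system; the sign condition holds for generalized
    Cartan matrices. *)
Theorem minuscule_module_exists m (A : 'M[int]_m) (Delta : {fset 'rV[R]_n})
    (sigma : 'I_m -> Delta) :
    minuscule Psi Delta -> cartan_labelling A sigma ->
    (forall i j, i != j -> A i j <= 0) ->
  exists rho : derived_km C A -> V -> V, minuscule_module sigma rho.
Proof.
move=> minP [_ AE] Ale0.
have [i|i j|rho [rhoM rhoE]] := km_module_exists bvec_out gl_eq glE_bvec glH_bvec
    (A := A) (root := fun i => val (sigma i)) _ _ Ale0.
- exact: minuscule_rootP minP (fsvalP _).
- by rewrite AE mulrA dotC.
exists rho; split=> // i; have [rE rF rH] := rhoE i.
by split=> x; rewrite ?rE ?rF ?rH (glE_opE, glE_opF, glH_opH).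
Qed.

Lemma opE_bvec a w : opE a (b w) = if w \in Psi then b (w + a) else 0.
Proof. by rewrite -glE_opE glE_bvec. Qed.

Lemma opF_bvec a w : opF a (b w) = if w \in Psi then b (w - a) else 0.
Proof. by rewrite -glE_opF glE_bvec. Qed.

Lemma opH_bvec a w : opH a (b w) = (coef w a)%:C%C *: b w.
Proof. by rewrite -glH_opH glH_bvec. Qed.

Lemma opH_coord a x (v : Psi) : opH a x v = (coef (val v) a)%:C%C * x v.
Proof.
rewrite /opH sum_ffunE (bigD1 v) //= big1 ?addr0 => [|w wv].
  by rewrite !ffunE eqxx /GRing.scale /= mulr1 mulrC.
by rewrite !ffunE (inj_eq val_inj) eq_sym (negPf wv) /GRing.scale /= !mulr0.
Qed.

End Operators.

(** * Weight vectors, irreducibility and isomorphisms *)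

Section ModuleTheory.
Variables (R : realType) (n : nat) (Psi Delta : {fset 'rV[R]_n}).
Variables (m : nat) (A : 'M[int]_m) (sigma : 'I_m -> Delta).
Local Notation C := R[i].
Local Notation V := (minV Psi).
Local Notation b := (bvec Psi).
Variable rho : derived_km C A -> V -> V.
Hypothesis sigma_bij : bijective sigma.
Hypothesis rhoP : minuscule_module sigma rho.
Implicit Types (v w : 'rV[R]_n).

Lemma weight_vector_bvec w : w \in Psi -> weight_vector rho (b w).
Proof.
move=> wP; split=> [|i]; first exact: bvec_neq0.
by have [_ _ ->] := rhoP.2 i; eexists; apply: opH_bvec.
Qed.

Lemma highest_weight_bvec w : w \in Psi ->
  (forall a, a \in Delta -> w + a \notin Psi) -> highest_weight_vector rho (b w).
Proof.
move=> wP top; split=> [|i]; first exact: weight_vector_bvec.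
by have [-> _ _] := rhoP.2 i; rewrite opE_bvec wP bvec_out // top ?fsvalP.
Qed.

Lemma lowest_weight_bvec w : w \in Psi ->
  (forall a, a \in Delta -> w - a \notin Psi) -> lowest_weight_vector rho (b w).
Proof.
move=> wP bot; split=> [|i]; first exact: weight_vector_bvec.
by have [_ -> _] := rhoP.2 i; rewrite opF_bvec wP bvec_out // bot ?fsvalP.
Qed.

(** The Lie algebra is generated by the Chevalley generators, so it acts as 0
    as soon as they do. *)
Lemma trivial_module_generators :
    (forall i x, [/\ rho (km_e C A i) x = 0, rho (km_f C A i) x = 0 &
                     rho (km_h C A i) x = 0]) ->
  trivial_module rho.
Proof.
move=> gen0; have [[linl linr rlie] _] := rhoP.
have rhoZ c s x : rho (c *: s) x = c *: rho s x.
  have zero : rho 0 x = 0.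
    by have := linl x (-1) 0 0; rewrite scaler0 addr0 scaleN1r addNr.
  by have := linl x c s 0; rewrite !addr0 zero addr0.
have rhoD s t x : rho (s + t) x = rho s x + rho t x.
  by have := linl x 1 s t; rewrite !scale1r.
elim/lclass_ind => t; elim: t => [[i|i|i]||s IHs t IHt|c t IHt|s IHs t IHt] x.
- by case: (gen0 i x).
- by case: (gen0 i x).
- by case: (gen0 i x).
- by have := rhoZ 0 0 x; rewrite !scale0r.
- by rewrite lclassD rhoD IHs IHt addr0.
- by rewrite lclassZ rhoZ IHt scaler0.
- by rewrite lclass_lie rlie IHs IHt subrr.
Qed.

Lemma trivial_module_coef0 : minuscule Psi Delta ->
  (forall v a, v \in Psi -> a \in Delta -> coef v a = 0) -> trivial_module rho.
Proof.
move=> minP c0; apply: trivial_module_generators => i x.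
have [-> -> ->] := rhoP.2 i; set a := val (sigma i).
have aD : a \in Delta by apply: fsvalP.
have am := minuscule_rootP minP aD.
split; apply: big1 => v _.
- by rewrite (addr_in am) ?fsvalP // c0 ?fsvalP // eq_sym oppr_eq0 oner_eq0 scaler0.
- by rewrite (subr_in am) ?fsvalP // c0 ?fsvalP // eq_sym oner_eq0 scaler0.
- by rewrite c0 ?fsvalP // scale0r scaler0.
Qed.

(** If the weights separate the elements of [Psi], projecting onto weight spaces
    shows that a nonzero submodule contains a basis vector: an element of
    minimal support in it is a multiple of one. *)
Lemma submodule_has_bvec (U : {pred V}) (u : V) :
    submod_closed U -> (forall s x, x \in U -> rho s x \in U) ->
    (forall v w, v \in Psi -> w \in Psi ->
       (forall a, a \in Delta -> coef v a = coef w a) -> v = w) ->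
    u \in U -> u != 0 ->
  exists2 w, w \in Psi & b w \in U.
Proof.
move=> [U0 Ulin] Ustab sep.
have UZ c x : x \in U -> c *: x \in U by move=> xU; rewrite -[_ *: _]addr0 Ulin.
have [k] := ubnP #|[pred v : Psi | u v != 0]|; elim: k u => // k IH u leuk uU u0.
have [v uv] : exists v : Psi, u v != 0.
  apply/existsP; apply: contraNT u0 => /existsPn u0.
  by apply/eqP/ffunP => v; rewrite ffunE; apply/eqP/negPn/u0.
have [/existsP[w /andP[wv uw]]|/existsPn only_v] :=
    boolP [exists w : Psi, (w != v) && (u w != 0)]; last first.
  exists (val v); first exact: fsvalP.
  have uE : u = u v *: b (val v).
    rewrite [LHS]minV_sum (bigD1 v) //= big1 ?addr0 // => w wv.
    by have := only_v w; rewrite wv /= => /negPn/eqP ->; rewrite scale0r.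
  by rewrite -[b _](scalerK uv) -uE UZ.
have [a aD cvw] : exists2 a, a \in Delta & coef (val w) a != coef (val v) a.
  apply: contrapT => same; case/eqP: wv; apply/val_inj/sep; rewrite ?fsvalP //.
  by move=> a aD; apply: contrapT => /eqP ?; apply: same; exists a.
have [i iE] : exists i, val (sigma i) = a.
  by case: sigma_bij => tau _ tauK; exists (tau [` aD]); rewrite tauK.
(* Applying [h_i] minus its eigenvalue on [b v] kills the coordinate at [v]
   but not that at [w]. *)
pose u' : V := - (coef (val v) a)%:C%C *: u + rho (km_h C A i) u.
have u'E (t : Psi) : u' t = (coef (val t) a - coef (val v) a)%:C%C * u t.
  have [_ _ hE] := rhoP.2 i.
  by rewrite !ffunE hE iE opH_coord rmorphB mulrBl addrC /GRing.scale /= mulNr.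
apply: (IH u').
- rewrite -ltnS; apply: leq_trans leuk; rewrite ltnS.
  apply: proper_card; apply/properP; split.
    apply/subsetP => t; rewrite !inE u'E mulf_eq0 negb_or => /andP[]//.
  by exists v; rewrite !inE ?uv // u'E subrr mul0r eqxx.
- by rewrite /u' Ulin ?Ustab.
- apply/eqP => /ffunP /(_ w) /eqP; rewrite u'E ffunE mulf_eq0 (negPf uw) orbF.
  by rewrite fmorph_eq0 subr_eq0 (negPf cvw).
Qed.

(** The basis vectors are linked by raising operators to that of the unique
    maximal element [top]; the vector [r], positive on [Delta], measures the
    height. *)
Theorem minuscule_irreducible (top r : 'rV[R]_n) :
    (forall a, a \in Delta -> 0 < dot a r) ->
    top \in Psi ->
    (forall v, v \in Psi -> v != top -> exists2 a, a \in Delta & v + a \in Psi) ->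
    (forall v w, v \in Psi -> w \in Psi ->
       (forall a, a \in Delta -> coef v a = coef w a) -> v = w) ->
  irreducible_module rho.
Proof.
move=> rpos topP raise sep; split; first by exists (b top); apply: bvec_neq0.
move=> U Usub Ustab.
have [[u uU u0]|no_u] := pselect (exists2 u, u \in U & u != 0); last first.
  by left=> v vU; apply: contrapT => /eqP v0; apply: no_u; exists v.
right; have [w0 w0P w0U] := submodule_has_bvec Usub Ustab sep uU u0.
have step v a : v \in Psi -> a \in Delta -> v + a \in Psi ->
    (b v \in U) = (b (v + a) \in U).
  move=> vP aD vaP; case: sigma_bij => tau _ tauK.
  have [eE fE _] := rhoP.2 (tau [` aD]); rewrite tauK /= in eE fE.
  apply/idP/idP => [/(Ustab (km_e C A (tau [` aD]))) |
                    /(Ustab (km_f C A (tau [` aD])))].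
    by rewrite eE opE_bvec vP.
  by rewrite fE opF_bvec vaP addrK.
pose ht (v : Psi) := dot (val v) r.
have htS (v : Psi) a (vaP : val v + a \in Psi) : a \in Delta -> (ht v < ht [` vaP])%R.
  by move=> aD; rewrite /ht /= dotDl ltrDl rpos.
(* A highest element with basis vector in [U] can only be [top]. *)
have topU : b top \in U.
  pose P := [pred v : Psi | b (val v) \in U].
  have P0 : P [` w0P] by [].
  case: (arg_maxP ht P0) => v vU vmax.
  have [<-//|vtop] := eqVneq (val v) top.
  have [a aD vaP] := raise _ (fsvalP v) vtop.
  have := vmax [` vaP]; rewrite /P /= -(step (val v)) ?fsvalP // => /(_ vU).
  by rewrite leNgt htS.
(* A highest element with basis vector outside [U] is not [top], so it can be
   raised, still outside [U]: a contradiction. *)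
have bU v : v \in Psi -> b v \in U.
  move=> vP; apply: contrapT => /negP vU.
  pose P := [pred v : Psi | b (val v) \notin U].
  have P0 : P [` vP] by [].
  case: (arg_maxP ht P0) => w wU wmax.
  have wtop : val w != top by apply: contraNneq wU => ->.
  have [a aD waP] := raise _ (fsvalP w) wtop.
  have := wmax [` waP]; rewrite /P /= -(step (val w)) ?fsvalP // => /(_ wU).
  by rewrite leNgt htS.
case: Usub => U0 Ulin v; rewrite (minV_sum v).
apply: (big_ind (fun x => x \in U)) => // [x y xU yU|w _].
  by rewrite -[x]scale1r Ulin.
by rewrite -[_ *: _]addr0 Ulin // bU // fsvalP.
Qed.

End ModuleTheory.

(** An isomorphism sends the basis vector at [w] to a nonzero vector of the same
    weight, so this weight is that of some [v] in [Psi']. *)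
Lemma not_isomorphic_weight (R : realType) n (Psi Psi' Delta : {fset 'rV[R]_n})
    m (A : 'M[int]_m) (sigma : 'I_m -> Delta)
    (rho : derived_km R[i] A -> minV Psi -> minV Psi)
    (rho' : derived_km R[i] A -> minV Psi' -> minV Psi') (w : 'rV[R]_n) :
    bijective sigma -> minuscule_module sigma rho -> minuscule_module sigma rho' ->
    w \in Psi ->
    (forall v, v \in Psi' -> exists2 a, a \in Delta & coef v a != coef w a) ->
  ~ isomorphic_modules rho rho'.
Proof.
move=> [tau _ tauK] rhoP rhoP' wP no_w [f [flin fbij fE]].
have f0 : f 0 = 0.
  by have := flin (-1) 0 0; rewrite scaler0 addr0 scaleN1r addNr.
have fZ c x : f (c *: x) = c *: f x by have := flin c x 0; rewrite f0 !addr0.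
have /eqP[] := bvec_neq0 wP; apply: (bij_inj fbij); rewrite f0.
apply/ffunP => v; rewrite [RHS]ffunE; apply/eqP.
have [a aD] := no_w _ (fsvalP v); apply: contraNT => fv.
have [_ _ hE] := rhoP.2 (tau [` aD]); have [_ _ hE'] := rhoP'.2 (tau [` aD]).
have := fE (km_h R[i] A (tau [` aD])) (bvec Psi w).
rewrite hE hE' tauK opH_bvec fZ => /ffunP/(_ v).
rewrite opH_coord ffunE => /(mulIf fv)/(fmorph_inj (real_complex R)) ->.
by [].
Qed.

(** * Integer coordinates *)

Section IntegerVectors.
Variable R : realType.
Implicit Types (s t v a : seq int) (L M : seq (seq int)).

(** The vector of [R^8] with the given list of integer coordinates. *)
Definition zvec s : 'rV[R]_8 := \row_(j < 8) (s`_j)%:~R.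

Definition zopp s : seq int := mkseq (fun k => - s`_k) 8.
Definition zadd s t : seq int := mkseq (fun k => s`_k + t`_k) 8.
Definition zdot s t : int := foldr (fun k c => s`_k * t`_k + c) 0 (iota 0 8).

Lemma zvecN s : zvec (zopp s) = - zvec s.
Proof. by apply/rowP => j; rewrite !mxE nth_mkseq // rmorphN. Qed.

Lemma zvecD s t : zvec (zadd s t) = zvec s + zvec t.
Proof. by apply/rowP => j; rewrite !mxE nth_mkseq // rmorphD. Qed.

Lemma dot_zvec s t : dot (zvec s) (zvec t) = (zdot s t)%:~R.
Proof.
rewrite /dot (eq_bigr (fun j : 'I_8 => (s`_j * t`_j)%:~R)) => [|j _].
  by rewrite -rmorph_sum /= -(big_mkord xpredT (fun k => s`_k * t`_k)) unlock.
by rewrite !mxE rmorphM.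
Qed.

Lemma zvec_inj s t : size s = 8%N -> size t = 8%N -> zvec s = zvec t -> s = t.
Proof.
move=> ss st /rowP st_eq; apply: (@eq_from_nth _ 0) => [|k]; first by rewrite ss.
by rewrite ss => k8; have /eqP := st_eq (Ordinal k8); rewrite !mxE eqr_int => /eqP.
Qed.

(** [L] lists the elements of [X] in integer coordinates. *)
Definition lists (X : {fset 'rV[R]_8}) L : Prop :=
  all (fun s => size s == 8%N) L /\ X =i map zvec L.

Lemma lists_in X L s : lists X L -> size s = 8%N -> (zvec s \in X) = (s \in L).
Proof.
move=> [/allP L8 ->] s8; apply/mapP/idP => [[t tL /zvec_inj-> //]|]; last by exists s.
exact/eqP/L8.
Qed.

Lemma listsP X L x : lists X L ->
  reflect (exists s, [/\ s \in L, size s = 8%N & x = zvec s]) (x \in X).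
Proof.
move=> [/allP L8 ->]; apply: (iffP mapP) => [[s sL ->]|[s [sL _ ->]]]; exists s => //.
by split=> //; apply/eqP/L8.
Qed.

Lemma lists_eq (X Y : {fset 'rV[R]_8}) L : lists X L -> lists Y L -> X = Y.
Proof. by move=> [_ XL] [_ YL]; apply/fsetP => x; rewrite XL YL. Qed.

Lemma lists_card X L : lists X L -> uniq L -> #|` X| = size L.
Proof.
move=> [/allP L8 XL] uL; have -> : X = [fset x in map zvec L].
  by apply/fsetP => x; rewrite XL inE.
rewrite card_fseq undup_id ?size_map // map_inj_in_uniq // => s t /L8/eqP s8 /L8/eqP t8.
exact: zvec_inj.
Qed.

Lemma lists_filter X Y L (p : seq int -> bool) : lists X L ->
  (forall s, s \in L -> (zvec s \in Y) = p s) -> {subset Y <= X} ->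
  lists Y (filter p L).
Proof.
move=> XL Yp YX; split=> [|x].
  by rewrite all_filter; apply: sub_all XL.1 => s /= ->; rewrite implybT.
apply/idP/mapP => [xY|[s]]; last by rewrite mem_filter => /andP[ps sL ->]; rewrite Yp.
have [s [sL _ xE]] := listsP _ XL (YX _ xY).
by exists s; rewrite // mem_filter sL -Yp // -xE xY.
Qed.

(** All members of [M] have squared length 32, like all the roots below. *)
Definition norm32 M := all (fun a => zdot a a == 32) M.

Lemma coef_zvec v a : zdot a a = 32 ->
  coef (zvec v) (zvec a) = (zdot v a)%:~R / 16.
Proof.
move=> a32; rewrite /coef !dot_zvec a32.
by rewrite (_ : 32%:~R = 32) // ; field.
Qed.

(** A decidable form of [minuscule] for roots of squared length 32: the
    coefficient at [a] is then the scalar product divided by 16. *)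
Definition zminuscule L M := all (fun v => all (fun a =>
  let c := zdot v a in
  [&& c \in [:: -16; 0; 16], (zadd v a \in L) == (c == -16) &
      (zadd v (zopp a) \in L) == (c == 16)]) M) L.

Lemma zminusculeP Psi Delta L M : lists Psi L -> lists Delta M ->
  norm32 M -> zminuscule L M -> minuscule Psi Delta.
Proof.
move=> PsiL DeltaM /allP M32 /allP minL; split.
  apply/negP => /(listsP _ DeltaM)[a [/M32/eqP a32 _ a0]].
  by have := dot_eq0 (zvec a); rewrite dot_zvec a32 -a0 eqxx intr_eq0.
move=> x y /(listsP _ PsiL)[v [vL v8 ->]] /(listsP _ DeltaM)[a [aM a8 ->]].
have /allP/(_ a aM)/and3P[cs /eqP addE /eqP subE] := minL v vL.
rewrite -zvecD -zvecN -zvecD !(lists_in PsiL) ?size_mkseq // addE subE.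
rewrite !dot_zvec (eqP (M32 _ aM)).
have [e16 eN16 e32] : [/\ 16%:~R = 16 :> R, (-16)%:~R = -16 :> R & 32%:~R = 32 :> R].
  by rewrite rmorphN.
have [n1 n2 n3] : [/\ -1 <> 1 :> R, 0 <> -1 :> R & 0 <> 1 :> R].
  by clear; split=> ?; lra.
move: cs; rewrite !inE => /or3P[] /eqP ->; [exists (-1) | exists 0 | exists 1];
  rewrite ?inE ?eqxx ?orbT // ?e16 ?eN16 ?e32; split=> //.
all: by [clear; lra | split=> // /esym].
Qed.

(** The order of [M] is the labelling of the nodes. *)
Lemma of_type_simply_laced (Delta : {fset 'rV[R]_8}) M (m : nat)
    (edges : seq (nat * nat)) :
    lists Delta M -> norm32 M -> uniq M -> size M = m ->
    all (fun i => all (fun j => zdot (nth [::] M i) (nth [::] M j) == 16 *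
        (if i == j then 2 else
         if ((i, j) \in edges) || ((j, i) \in edges) then -1 else 0))
      (iota 0 m)) (iota 0 m) ->
  of_type (simply_laced m edges) Delta.
Proof.
move=> DM /allP M32 uM Mm /allP AM; have /allP M8 := DM.1.
have nthM (i : 'I_m) : (nth [::] M i) \in M by rewrite mem_nth // Mm.
have nthD (i : 'I_m) : zvec (nth [::] M i) \in Delta.
  by rewrite (lists_in DM) // (eqP (M8 _ _)).
have inj : injective (fun i => [` nthD i]).
  move=> i j /(congr1 val)/= /zvec_inj eqM; apply/val_inj/eqP.
  by rewrite /= -(nth_uniq [::] _ _ uM) ?Mm // eqM // (eqP (M8 _ _)).
exists (fun i => [` nthD i]); split.
  apply: inj_card_bij => //.
  by rewrite -cardfE (lists_card DM) // Mm card_ord.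
move=> i j /=; rewrite !mxE !dot_zvec (eqP (M32 _ (nthM i))).
have mem_iota8 (k : 'I_m) : (k : nat) \in iota 0 m by rewrite mem_iota ltn_ord.
have /allP/(_ j (mem_iota8 j))/eqP -> := AM i (mem_iota8 i).
rewrite -val_eqE /=; set c := (if _ then _ else _).
rewrite rmorphM /= (_ : 16%:~R = 16) // (_ : 32%:~R = 32) //.
by move: (c%:~R) => {}c; field.
Qed.

(** A decidable form of the hypotheses of [minuscule_irreducible]. *)
Definition zirreducible L M top r :=
  [&& all (fun a => 0 < zdot a r) M, top \in L,
      all (fun v => (v == top) || has (fun a => zadd v a \in L) M) L &
      uniq [seq [seq zdot v a | a <- M] | v <- L]].

Section Checks.
Variables (Psi Delta : {fset 'rV[R]_8}) (L M : seq (seq int)).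
Hypotheses (PsiL : lists Psi L) (DeltaM : lists Delta M).
Hypothesis M32 : norm32 M.
Variables (m : nat) (A : 'M[int]_m) (sigma : 'I_m -> Delta).
Variable rho : derived_km R[i] A -> minV Psi -> minV Psi.
Hypothesis sigma_bij : bijective sigma.
Hypothesis rhoP : minuscule_module sigma rho.

Lemma zirreducibleP top r :
  zirreducible L M top r -> irreducible_module rho.
Proof.
move=> /and4P[/allP rpos topL /allP up uL].
have L8 s : s \in L -> size s = 8%N by move=> sL; apply/eqP/(allP PsiL.1).
apply: (minuscule_irreducible sigma_bij rhoP (top := zvec top) (r := zvec r)).
- by move=> x /(listsP _ DeltaM)[a [/rpos a0 _ ->]]; rewrite dot_zvec ltr0z.
- by rewrite (lists_in PsiL) ?L8.
- move=> x /(listsP _ PsiL)[v [vL v8 ->]] vtop.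
  have /orP[/eqP vE|/hasP[a aM vaL]] := up _ vL; first by rewrite vE eqxx in vtop.
  exists (zvec a); last by rewrite -zvecD (lists_in PsiL) ?size_mkseq.
  by rewrite (lists_in DeltaM) // (eqP (allP DeltaM.1 _ aM)).
- move=> x y /(listsP _ PsiL)[v [vL v8 ->]] /(listsP _ PsiL)[w [wL w8 ->]] vw.
  congr zvec; have := uL => /(uniqP [::]); rewrite size_map => inj.
  rewrite -(nth_index [::] vL) -(nth_index [::] wL); congr nth.
  apply: inj; rewrite ?inE ?index_mem // !(nth_map [::]) ?index_mem // !nth_index //.
  apply/eq_in_map => a aM; apply: (@intr_inj R).
  have a32 : zdot a a = 32 by apply/eqP/(allP M32).
  have aD : zvec a \in Delta by rewrite (lists_in DeltaM) // (eqP (allP DeltaM.1 _ aM)).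
  have := vw _ aD; rewrite !coef_zvec // => /divIf; apply.
  by rewrite pnatr_eq0.
Qed.

Lemma zhighest_weight w : w \in L -> all (fun a => zadd w a \notin L) M ->
  highest_weight_vector rho (bvec Psi (zvec w)).
Proof.
move=> wL /allP wM; apply: (highest_weight_bvec rhoP).
  by rewrite (lists_in PsiL) // (eqP (allP PsiL.1 _ wL)).
move=> x /(listsP _ DeltaM)[a [/wM waL _ ->]].
by rewrite -zvecD (lists_in PsiL) ?size_mkseq.
Qed.

Lemma zlowest_weight w : w \in L -> all (fun a => zadd w (zopp a) \notin L) M ->
  lowest_weight_vector rho (bvec Psi (zvec w)).
Proof.
move=> wL /allP wM; apply: (lowest_weight_bvec rhoP).
  by rewrite (lists_in PsiL) // (eqP (allP PsiL.1 _ wL)).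
move=> x /(listsP _ DeltaM)[a [/wM waL _ ->]].
by rewrite -zvecN -zvecD (lists_in PsiL) ?size_mkseq.
Qed.

End Checks.

End IntegerVectors.

(** * The 56 weights *)

(** The coordinates of [vv i j], for [i != j]. *)
Definition zvv (i j : nat) : seq int :=
  mkseq (fun k => if (k == i) || (k == j) then 3 else -1) 8.

(** The coordinates of [alpha i]. *)
Definition zalpha (i : nat) : seq int :=
  mkseq (fun k => if (i < 7)%N then if k == i then 4 else if k == i.+1 then -4 else 0
                  else if (k < 4)%N then -2 else 2) 8.

(** The root [4 (epsilon_0 - epsilon_7)]. *)
Definition zalpha' : seq int := [:: 4; 0; 0; 0; 0; 0; 0; -4].

(** The 56 vectors of [Psi56]. *)
Definition z56 : seq (seq int) :=
  let P := [seq zvv ij.1 ij.2 |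
    ij <- [seq (i, j) | i <- iota 0 8, j <- iota 0 8] & (ij.1 < ij.2)%N] in
  P ++ map zopp P.

(** The level sets of the scalar product with [vv 0 7]. *)
Definition zlevel (l : int) := [seq v <- z56 | zdot v (zvv 0 7) == l].

(** The simple systems, ordered as the nodes of the respective diagrams. *)
Definition zDelta : seq (seq int) := map zalpha (iota 0 8).
Definition zDelta_E7 : seq (seq int) := map zalpha (iota 1 7).
Definition zDelta_E6 : seq (seq int) := map zalpha [:: 1; 2; 3; 4; 5; 7]%N.
Definition zDelta_E61 : seq (seq int) :=
  zalpha' :: map zalpha [:: 1; 2; 3; 4; 5; 7]%N.

(** A height vector: it has positive scalar product with each of [alpha_1], ...,
    [alpha_7]. *)
Definition zheight : seq int := [:: -9; 7; 6; 5; 4; 3; 2; 1].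

Section FiftySixCoordinates.
Variable R : realType.

Lemma sum_eps (j : 'I_8) : (\sum_(k < 8) eps k : 'rV[R]_8) 0 j = 1.
Proof.
rewrite summxE (bigD1 j) //= mxE eqxx big1 ?addr0 // => k kj.
by rewrite mxE eq_sym (inj_eq val_inj) (negPf kj).
Qed.

Lemma vv_zvec i j : i != j -> vv i j = zvec R (zvv i j).
Proof.
move=> ij; apply/rowP => k; rewrite !mxE sum_eps nth_mkseq //.
have [->|ki] := eqVneq; first by rewrite (negPf ij) /= addr0; ring.
have [_|kj] := eqVneq; rewrite /=.
  by rewrite add0r; ring.
by rewrite addr0; ring.
Qed.

Lemma alpha_zvec i : alpha i = zvec R (zalpha i).
Proof.
apply/rowP => k; rewrite /alpha mxE nth_mkseq //.
case: ifP => _; rewrite !mxE; last by case: ifP.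
have [->|ki] := eqVneq (k : nat) i; first by rewrite ltn_eqF // subr0 mulr1.
by have [_|_] := eqVneq (k : nat) i.+1; rewrite ?subr0 ?sub0r ?mulr0 ?mulrN1.
Qed.

Lemma alpha'_zvec : 4 *: (eps 0 - eps 7) = zvec R zalpha'.
Proof.
apply/rowP => k; rewrite !mxE.
by case: k => [[|[|[|[|[|[|[|[|k]]]]]]]] //= _];
  rewrite ?subrr ?subr0 ?sub0r ?mulr0 ?mulr1 ?mulrN1.
Qed.

Lemma lists56 : lists (@Psi56 R) z56.
Proof.
split=> // x; set P := [seq zvv ij.1 ij.2 |
  ij <- [seq (i, j) | i <- iota 0 8, j <- iota 0 8] & (ij.1 < ij.2)%N].
rewrite -[z56]/(P ++ map zopp P) map_cat mem_cat /Psi56 in_fsetU.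
set X := (X in x \in X).
have XP y : (y \in X) = (y \in map (zvec R) P).
  apply/imfset2P/mapP => [[i i8 [j]]|[s /mapP[[i j]]]].
    case/andP=> j8 ij ->; exists (zvv i j); last by rewrite vv_zvec ?ltn_eqF.
    apply/mapP; exists (i, j) => //; rewrite mem_filter; apply/andP; split=> //.
    by apply/allpairsPdep; exists i, j.
  rewrite mem_filter => /andP[ij /allpairsPdep[i' [j' [i8 j8 [iE jE]]]]] -> ->.
  rewrite -iE in i8; rewrite -jE in j8.
  exists i => //; exists j; last by rewrite vv_zvec ?ltn_eqF.
  by apply/andP.
congr (_ || _); first exact: XP.
apply/imfsetP/mapP => [[y yX ->]|[s /mapP[t tP ->] ->]].
  have /mapP[s sP ->] : y \in map (zvec R) P by rewrite -XP.
  by exists (zopp s); rewrite ?zvecN // map_f.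
by exists (zvec R t); rewrite ?zvecN //= XP map_f.
Qed.

Lemma lists_Delta8 : lists (@Delta8 R) zDelta.
Proof.
split=> // x; apply/imfsetP/mapP => [[i i8 ->]|[s /mapP[i i8 ->] ->]].
  by exists (zalpha i); rewrite ?alpha_zvec ?map_f.
by exists i; rewrite ?alpha_zvec.
Qed.

Lemma in_level (n : 'rV[R]_8) l v :
  (v \in level n l) = (v \in Psi56) && (dot v n == l).
Proof. by rewrite in_fset. Qed.

Lemma in_orth_simple (n : 'rV[R]_8) a :
  (a \in orth_simple n) = (a \in Delta8) && (dot a n == 0).
Proof. by rewrite in_fset. Qed.

Lemma lists_level (k : int) (l : R) :
  k%:~R = l -> lists (level (vv 0 7) l) (zlevel k).
Proof.
move=> <-; apply: lists_filter lists56 _ _ => [s sL|x]; last first.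
  by rewrite in_level => /andP[].
rewrite in_level (lists_in lists56) ?sL; last exact/eqP/(allP lists56.1).
by rewrite vv_zvec // dot_zvec eqr_int.
Qed.

Lemma lists_filter_eq (X Y : {fset 'rV[R]_8}) L M (p : seq int -> bool) :
  lists X L -> (forall s, s \in L -> (zvec R s \in Y) = p s) ->
  {subset Y <= X} -> filter p L = M -> lists Y M.
Proof. by move=> XL Yp YX <-; apply: lists_filter XL Yp YX. Qed.

Lemma lists_DeltaD1 : lists (@Delta8 R `\ alpha 0) zDelta_E7.
Proof.
apply: (@lists_filter_eq _ _ _ _ (fun s => s != zalpha 0))
  lists_Delta8 _ _ _ => [s sL|x|].
- rewrite in_fsetD1 (lists_in lists_Delta8) ?sL ?andbT; last first.
    exact/eqP/(allP lists_Delta8.1).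
  rewrite alpha_zvec; apply/negb_inj; rewrite !negbK.
  apply/eqP/eqP => [/zvec_inj->|->] //; exact/eqP/(allP lists_Delta8.1).
- by rewrite in_fsetD1 => /andP[].
- by vm_compute.
Qed.

Lemma lists_orth : lists (@orth_simple R (vv 0 7)) zDelta_E6.
Proof.
apply: (@lists_filter_eq _ _ _ _ (fun s => zdot s (zvv 0 7) == 0))
  lists_Delta8 _ _ _ => [s sL|x|].
- rewrite in_orth_simple (lists_in lists_Delta8) ?sL; last first.
    exact/eqP/(allP lists_Delta8.1).
  by rewrite vv_zvec // dot_zvec intr_eq0.
- by rewrite in_orth_simple => /andP[].
- by vm_compute.
Qed.

Lemma lists_orth' :
  lists (@orth_simple R (vv 0 7) `|` [fset 4 *: (eps 0 - eps 7)]) zDelta_E61.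
Proof.
split=> // x; rewrite in_fsetU in_fset1 alpha'_zvec lists_orth.2.
by rewrite [map _ _]/= in_cons orbC.
Qed.

Lemma orth_simpleE :
  @orth_simple R (vv 0 7) = Delta8 `\` [fset alpha 0; alpha 6].
Proof.
apply: (lists_eq lists_orth).
apply: (@lists_filter_eq _ _ _ _ (fun s => s \notin [:: zalpha 0; zalpha 6]))
  lists_Delta8 _ _ _ => [s sL|x|].
- have s8 : size s = 8%N by apply/eqP/(allP lists_Delta8.1).
  rewrite in_fsetD (lists_in lists_Delta8) ?sL ?andbT // !inE !alpha_zvec.
  by congr (~~ (_ || _)); apply/eqP/eqP => [/zvec_inj->|->].
- by rewrite in_fsetD => /andP[].
- by vm_compute.
Qed.

(** The finite verification on which minusculeness of all the systems rests. *)
Lemma minuscule56 :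
  minuscule Psi56 (@Delta8 R `|` [fset 4 *: (eps 0 - eps 7)]).
Proof.
have ls : lists (@Delta8 R `|` [fset 4 *: (eps 0 - eps 7)]) (zalpha' :: zDelta).
  split=> // x; rewrite in_fsetU in_fset1 alpha'_zvec lists_Delta8.2.
  by rewrite [map _ _]/= in_cons orbC.
apply: (zminusculeP lists56 ls); by vm_compute.
Qed.

Lemma minuscule56_Delta8 : minuscule Psi56 (@Delta8 R).
Proof. by apply: minusculeS minuscule56 => a; rewrite in_fsetU => ->. Qed.

Lemma minuscule_level (l : R) :
  minuscule (level (vv 0 7) l)
    (orth_simple (vv 0 7) `|` [fset 4 *: (eps 0 - eps 7)]).
Proof.
apply: (minuscule_slice (fun v => in_level (vv 0 7) l v)) => [a|].
  move/(listsP _ lists_orth') => [s [sM _ ->]]; rewrite vv_zvec // dot_zvec.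
  have /allP/(_ s sM)/eqP-> // : all (fun s => zdot s (zvv 0 7) == 0) zDelta_E61.
  by vm_compute.
apply: minusculeS minuscule56 => a; rewrite !in_fsetU in_orth_simple.
by case/orP => [/andP[->]|->]; rewrite ?orbT.
Qed.

Lemma four_levels : @Psi56 R =
  level (vv 0 7) 24 `|` level (vv 0 7) 8 `|` level (vv 0 7) (-8)
    `|` level (vv 0 7) (-24).
Proof.
apply/fsetP => v.
rewrite [RHS]in_fsetU [X in X || _]in_fsetU [X in X || _ || _]in_fsetU.
rewrite !in_level -!andb_orr; case: (boolP (v \in Psi56)) => //= vP.
have [s [sL _ ->]] := listsP _ lists56 vP.
have /allP/(_ s sL) : all (fun s => zdot s (zvv 0 7) \in [:: 24; 8; -8; -24]) z56.
  by vm_compute.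
by rewrite vv_zvec // dot_zvec !inE => /or4P[] /eqP ->;
  rewrite ?rmorphN /= eqxx ?orbT.
Qed.

Lemma of_type_E7_1 : of_type cartan_E7_1 (@Delta8 R).
Proof. by apply: (of_type_simply_laced lists_Delta8); vm_compute. Qed.

Lemma of_type_E7 : of_type cartan_E7 (@Delta8 R `\ alpha 0).
Proof. by apply: (of_type_simply_laced lists_DeltaD1); vm_compute. Qed.

Lemma of_type_E6 : of_type cartan_E6 (@orth_simple R (vv 0 7)).
Proof. by apply: (of_type_simply_laced lists_orth); vm_compute. Qed.

Lemma of_type_E6_1 : of_type cartan_E6_1
  (@orth_simple R (vv 0 7) `|` [fset 4 *: (eps 0 - eps 7)]).
Proof. by apply: (of_type_simply_laced lists_orth'); vm_compute. Qed.

End FiftySixCoordinates.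

Lemma simply_laced_le0 m edges (i j : 'I_m) :
  i != j -> simply_laced m edges i j <= 0.
Proof. by move=> /negPf ij; rewrite mxE ij; case: ifP. Qed.

Theorem proposition4p3 (R : realType) :
  let C : fieldType := R[i] in
  let E71 := derived_km C cartan_E7_1 in
  let e7 := derived_km C cartan_E7 in
  let e6 := derived_km C cartan_E6 in
  let E61 := derived_km C cartan_E6_1 in
  let n : 'rV[R]_8 := vv 0 7 in
  let Psi : {fset 'rV[R]_8} := Psi56 in
  let Delta : {fset 'rV[R]_8} := Delta8 in
  let Delta' : {fset 'rV[R]_8} := Delta `\ alpha 0 in
  let Delta_n : {fset 'rV[R]_8} := orth_simple n in
  let Delta_n' : {fset 'rV[R]_8} := Delta_n `|` [fset 4 *: (eps 0 - eps 7)] in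
  let levels : seq R := [:: 24; 8; -8; -24] in
  (* (i) *)
  [/\ #|` Psi | = 56%N,
      \dim {: minV Psi } = 56%N,
      minuscule Psi Delta,
      of_type cartan_E7_1 Delta &
      forall sigma : 'I_8 -> Delta,
        cartan_labelling cartan_E7_1 sigma ->
        exists rho : E71 -> minV Psi -> minV Psi,
          minuscule_module sigma rho] /\
  (* (ii) *)
  [/\ minuscule Psi Delta',
      of_type cartan_E7 Delta' &
      forall sigma : 'I_7 -> Delta',
        cartan_labelling cartan_E7 sigma ->
        exists rho : e7 -> minV Psi -> minV Psi,
          [/\ minuscule_module sigma rho,
              irreducible_module rho,
              highest_weight_vector rho (bvec Psi (- vv 0 7)) &
              lowest_weight_vector rho (bvec Psi (vv 0 7))]] /\
  (* (iii) *)
  ([/\ Psi = level n 24 `|` level n 8 `|` level n (-8) `|` level n (-24),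
       forall l m : R, l \in levels -> m \in levels -> l != m ->
         [disjoint level n l & level n m]%fset,
       Delta_n = Delta `\` [fset alpha 0; alpha 6],
       forall l : R, l \in levels -> minuscule (level n l) Delta_n &
       of_type cartan_E6 Delta_n] /\
   forall sigma : 'I_6 -> Delta_n,
     cartan_labelling cartan_E6 sigma ->
     exists rho : forall l : R, e6 -> minV (level n l) -> minV (level n l),
       [/\ forall l, l \in levels -> minuscule_module sigma (rho l),
           forall l, l \in [:: 24; -24] ->
             \dim {: minV (level n l)} = 1%N /\ trivial_module (rho l),
           forall l, l \in [:: 8; -8] ->
             \dim {: minV (level n l)} = 27%N /\ irreducible_module (rho l),
           ~ isomorphic_modules (rho 8) (rho (-8)) &
           [/\ highest_weight_vector (rho 8) (bvec (level n 8) (vv 1 7)),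
               lowest_weight_vector (rho 8) (bvec (level n 8) (vv 0 6)),
               highest_weight_vector (rho (-8))
                 (bvec (level n (-8)) (- vv 0 6)) &
               lowest_weight_vector (rho (-8))
                 (bvec (level n (-8)) (- vv 1 7))]]) /\
  (* (iv) *)
  [/\ forall l : R, l \in levels -> minuscule (level n l) Delta_n',
      of_type cartan_E6_1 Delta_n' &
      forall sigma : 'I_7 -> Delta_n',
        cartan_labelling cartan_E6_1 sigma ->
        forall l : R, l \in levels ->
        exists rho : E61 -> minV (level n l) -> minV (level n l),
          minuscule_module sigma rho].
Proof.
move=> C E71 e7 e6 E61 n Psi Delta Delta' Delta_n Delta_n' levels.
have L24 : lists (level n 24) (zlevel 24) by apply: lists_level.
have L8 : lists (level n 8) (zlevel 8) by apply: lists_level.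
have LN8 : lists (level n (-8)) (zlevel (-8)) by apply: lists_level; rewrite rmorphN.
have LN24 : lists (level n (-24)) (zlevel (-24)).
  by apply: lists_level; rewrite rmorphN.
split; [|split; [|split]].
- split.
  + by rewrite (lists_card (lists56 R)); vm_compute.
  + by rewrite dim_minV (lists_card (lists56 R)); vm_compute.
  + exact: minuscule56_Delta8 R.
  + exact: of_type_E7_1.
  + move=> sigma lab; apply: minuscule_module_exists lab _.
      exact: minuscule56_Delta8 R.
    exact: simply_laced_le0.
- have minD' : minuscule Psi Delta'.
    apply: minusculeS (minuscule56_Delta8 R) => a.
    by rewrite in_fsetD1 => /andP[].
  split=> // [|sigma lab]; first exact: of_type_E7.
  have [rho rhoP] := minuscule_module_exists minD' lab (@simply_laced_le0 _ _).
  have ls := lists_DeltaD1 R.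
  exists rho; split=> //.
  + apply: (zirreducibleP (lists56 R) ls _ lab.1 rhoP
      (top := zopp (zvv 0 7)) (r := zheight)); by vm_compute.
  + rewrite vv_zvec // -zvecN.
    by apply: (zhighest_weight (lists56 R) ls rhoP); vm_compute.
  + rewrite vv_zvec //.
    by apply: (zlowest_weight (lists56 R) ls rhoP); vm_compute.
- have minl l : minuscule (level n l) Delta_n.
    by apply: minusculeS (minuscule_level l) => a aD; rewrite in_fsetU aD.
  have ls := lists_orth R.
  split.
    split=> //; last exact: of_type_E6.
    + exact: four_levels.
    + move=> l m _ _ lm; apply/fdisjointP => v; rewrite !in_level => /andP[_ /eqP ->].
      by rewrite (negPf lm) andbF.
    + exact: orth_simpleE.
  move=> sigma lab.
  have [rho rhoP] : exists rho : forall l,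
      derived_km R[i] cartan_E6 -> minV (level n l) -> minV (level n l),
      forall l, minuscule_module sigma (rho l).
    have ex l := minuscule_module_exists (minl l) lab (@simply_laced_le0 _ _).
    by exists (fun l => sval (cid (ex l))) => l; apply: svalP.
  exists rho.
  split=> //.
  + have triv l L : lists (level n l) L -> size L = 1%N -> uniq L ->
        all (fun v => all (fun a => zdot v a == 0) zDelta_E6) L ->
        \dim {: minV (level n l)} = 1%N /\ trivial_module (rho l).
      move=> lsL sL uL /allP L0; split; first by rewrite dim_minV (lists_card lsL).
      apply: (trivial_module_coef0 (rhoP l) (minl l)) => x y.
      move=> /(listsP _ lsL)[v [vL _ ->]] /(listsP _ ls)[a [aM _ ->]].
      by rewrite /coef !dot_zvec (eqP (allP (L0 v vL) a aM)) mulr0 mul0r.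
    move=> l; rewrite !inE => /orP[] /eqP ->.
      by apply: triv L24 _ _ _; vm_compute.
    by apply: triv LN24 _ _ _; vm_compute.
  (* [zheight] works for [E6] too, whose simple roots are among
     [alpha_1], ..., [alpha_7]. *)
  + have irr l L top : lists (level n l) L -> size L = 27%N -> uniq L ->
        zirreducible L zDelta_E6 top zheight ->
        \dim {: minV (level n l)} = 27%N /\ irreducible_module (rho l).
      move=> lsL sL uL irrL; split; first by rewrite dim_minV (lists_card lsL).
      by apply: (zirreducibleP lsL ls _ lab.1 (rhoP l) irrL); vm_compute.
    move=> l; rewrite !inE => /orP[] /eqP ->.
      by apply: (irr _ _ (zvv 1 7)) L8 _ _ _; vm_compute.
    by apply: (irr _ _ (zopp (zvv 0 6))) LN8 _ _ _; vm_compute.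
  (* No element of level -8 has the weight of the highest weight vector of
     level 8. *)
  + apply: (not_isomorphic_weight (w := zvec R (zvv 1 7)) lab.1 (rhoP 8) (rhoP (-8))).
      by rewrite (lists_in L8) //; vm_compute.
    move=> x /(listsP _ LN8)[v [vL v8 ->]].
    have /allP/(_ v vL)/hasP[a aM va] : all (fun v => has (fun a =>
        zdot v a != zdot (zvv 1 7) a) zDelta_E6) (zlevel (-8)) by vm_compute.
    have a32 : zdot a a = 32.
      by apply/eqP; move: a aM {va}; apply/allP; vm_compute.
    exists (zvec R a).
      by rewrite (lists_in ls) //; apply/eqP/(allP ls.1).
    rewrite !coef_zvec //; apply: contraNneq va => /divIf/intr_inj -> //.
    by rewrite pnatr_eq0.
  + rewrite !vv_zvec // -!zvecN; split.
    * by apply: (zhighest_weight L8 ls (rhoP 8)); vm_compute.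
    * by apply: (zlowest_weight L8 ls (rhoP 8)); vm_compute.
    * by apply: (zhighest_weight LN8 ls (rhoP (-8))); vm_compute.
    * by apply: (zlowest_weight LN8 ls (rhoP (-8))); vm_compute.
- split=> [l _||sigma lab l _]; first exact: minuscule_level.
    exact: of_type_E6_1.
  exact: minuscule_module_exists (minuscule_level l) lab (@simply_laced_le0 _ _).
Qed.
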